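(* Let $N \geq 1$ be an integer and let $c_0, \ldots, c_{N-1}$ be given complex numbers. Then there exist at least one and at most $N!$ different $N$-periodic potentials $b : \mathbb{Z} \to \mathbb{C}$ for which the discrete Hill discriminant of the corresponding discrete Schr\''{o}dinger operator $L_{\text{Schr}}$ is $$\Delta(\lambda) = (-1)^N \lambda^N + \sum_{k=0}^{N-1} c_k \lambda^k .$$
   Context: For an $N$-periodic function $b : \mathbb{Z} \to \mathbb{C}$ (i.e. $b(n+N) = b(n)$ for all $n \in \mathbb{Z}$), the discrete periodic Schr\''{o}dinger operator with potential $b$ is $$(L_{\text{Schr}}\, w)(n) := -w(n+1) - w(n-1) + b(n) w(n), \qquad n \in \mathbb{Z}.$$ For $\lambda \in \mathbb{C}$, let $\chi(n) = \chi(n;\lambda)$ and $\gamma(n) = \gamma(n;\lambda)$ be the solutions of $(L_{\text{Schr}}\, w)(n) = \lambda w(n)$, $n \in \mathbb{Z}$, with $\chi(0) = 1$, $\chi(1) = 0$ and $\gamma(0) = 0$, $\gamma(1) = 1$. The (discrete) Hill discriminant of $L_{\text{Schr}}$ (relative to the period $N$) is the polynomial in $\lambda$ $$\Delta(\lambda) := \chi(N;\lambda) + \gamma(N+1;\lambda),$$ i.e. the trace of the $N$-shift $w(\cdot) \mapsto w(\cdot + N)$ acting on the two-dimensional space of solutions of $L_{\text{Schr}}\, w = \lambda w$. Two potentials are different if they differ as functions on $\mathbb{Z}$. *)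

(* Defs.v *)
From HB Require Import structures.
From mathcomp Require Import all_boot all_order all_algebra.
From mathcomp Require Import ring zify complex.
From mathcomp Require Import boolp classical_sets functions cardinality reals trigo.

Set Implicit Arguments.
Unset Strict Implicit.
Unset Printing Implicit Defensive.

Import Order.TTheory GRing.Theory Num.Theory.

Local Open Scope classical_set_scope.
Local Open Scope ring_scope.

Section Schroedinger.
Variable C : comNzRingType.
Implicit Types (b w : int -> C) (l x y : C) (n : int).

Definition schr b w : int -> C := fun n => - w (n + 1) - w (n - 1) + b n * w n.

Definition schr_solution b l x y : set (int -> C) :=
  [set w | [/\ forall n, schr b w n = l * w n, w 0 = x & w 1 = y]].

(* The default value is never used: see [schr_solP] and [schr_solution_unique]. *)
Definition schr_sol b l x y : int -> C := xget (fun=> 0) (schr_solution b l x y).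

Definition schr_chi b l := schr_sol b l 1 0.

Definition schr_gamma b l := schr_sol b l 0 1.

Definition hill_discriminant (N : nat) b l : C :=
  schr_chi b l N%:Z + schr_gamma b l (N%:Z + 1).

Lemma schr_eqE b l w n : (schr b w n = l * w n) <->
  (w (n + 1) = (b n - l) * w n - w (n - 1)).
Proof.
rewrite /schr; split => [h|->]; last by ring.
have -> : w (n + 1) = b n * w n - w (n - 1)
    - (- w (n + 1) - w (n - 1) + b n * w n) by ring.
by rewrite h; ring.
Qed.

(* The pairs (w n, w (n + 1)) for n >= 0. *)
Fixpoint schr_fwd b l (p : C * C) (n : nat) : C * C :=
  if n is m.+1 then
    let q := schr_fwd b l p m in (q.2, (b m.+1%:Z - l) * q.2 - q.1)
  else p.

(* The pairs (w (- n), w (1 - n)) for n >= 0. *)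
Fixpoint schr_bwd b l (p : C * C) (n : nat) : C * C :=
  if n is m.+1 then
    let q := schr_bwd b l p m in ((b (- m%:Z) - l) * q.1 - q.2, q.1)
  else p.

Lemma schr_bwdSS b l p m : (schr_bwd b l p m.+2).1 =
  (b (- m.+1%:Z) - l) * (schr_bwd b l p m.+1).1 - (schr_bwd b l p m).1.
Proof. by []. Qed.

Lemma schr_solution_exists b l x y : schr_solution b l x y !=set0.
Proof.
exists (fun n => match n with
  | Posz m => (schr_fwd b l (x, y) m).1
  | Negz m => (schr_bwd b l (x, y) m.+1).1 end).
split => // n; apply/schr_eqE; case: n => [[|m]|[|m]].
- rewrite (_ : 0%:Z + 1 = 1%:Z) // (_ : 0%:Z - 1 = Negz 0) //=.
  by rewrite oppr0; ring.
- rewrite (_ : m.+1%:Z + 1 = m.+2%:Z); last by lia.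
  by rewrite (_ : m.+1%:Z - 1 = m%:Z) //; lia.
- by rewrite (_ : Negz 0 + 1 = 0%:Z) // (_ : Negz 0 - 1 = Negz 1) //= oppr0 -[Negz 0]/(- 1%:Z); ring.
- rewrite (_ : Negz m.+1 + 1 = Negz m); last by lia.
  rewrite (_ : Negz m.+1 - 1 = Negz m.+2); last by lia.
  by rewrite NegzE [(schr_bwd _ _ _ m.+3).1]schr_bwdSS; ring.
Qed.

Lemma schr_solP b l x y : schr_solution b l x y (schr_sol b l x y).
Proof. exact: xgetPex (schr_solution_exists b l x y). Qed.

Lemma schr_solution_unique b l x y w w' :
  schr_solution b l x y w -> schr_solution b l x y w' -> w = w'.
Proof.
move=> [e w0 w1] [e' w0' w1'].
have pos m : w m%:Z = w' m%:Z /\ w m.+1%:Z = w' m.+1%:Z.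
  elim: m => [|m [h1 h2]]; first by rewrite w0 w1 w0' w1'.
  split=> //; move/schr_eqE: (e m.+1%:Z); move/schr_eqE: (e' m.+1%:Z).
  rewrite (_ : m.+1%:Z + 1 = m.+2%:Z); last by lia.
  rewrite (_ : m.+1%:Z - 1 = m%:Z); last by lia.
  by rewrite -h1 -h2 => -> ->.
have neg m : w (- m%:Z) = w' (- m%:Z) /\ w (1 - m%:Z) = w' (1 - m%:Z).
  elim: m => [|m [h1 h2]]; first by rewrite oppr0 addr0 w0 w1 w0' w1'.
  have -> : 1 - m.+1%:Z = - m%:Z by lia.
  split=> //; have -> : - m.+1%:Z = - m%:Z - 1 by lia.
  have back v : (forall n, schr b v n = l * v n) ->
      v (- m%:Z - 1) = (b (- m%:Z) - l) * v (- m%:Z) - v (1 - m%:Z).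
    by move=> /(_ (- m%:Z))/schr_eqE; rewrite [1 - _]addrC => ->; ring.
  by rewrite (back w) // (back w') // h1 h2.
apply/funext => -[m|m]; first by case: (pos m).
by rewrite NegzE; case: (neg m.+1).
Qed.

End Schroedinger.

(* Main.v *)
(* Up to sign and order, the coefficients of the discriminant are polynomials
   f_1, ..., f_N in the values of the potential over one period, and f_j equals
   the elementary symmetric polynomial e_j up to terms of lower degree.
   - The Artin monomials x^a with a_i < N - i, of which there are N!, span
     C[x] over C[e], hence also over C[f] by induction on the degree. Modulo the
     ideal (f - c) they therefore span C[x] over C, and evaluations at distinct
     solutions are linearly independent: there are at most N! solutions.
   - The f_j are algebraically independent because the e_j are, so by
     Nakayama's lemma 1 is not in (f - c). Each variable is algebraic modulo
     this ideal, so one can adjoin successively some x_i - r_i and keep a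
     proper ideal; the point r is then a solution. *)

Require Import Defs.
From HB Require Import structures.
From mathcomp Require Import all_boot all_order all_algebra complex.
From mathcomp Require Import boolp classical_sets functions cardinality reals trigo.
From mathcomp Require Import ring zify.
From mathcomp Require Import -(notations) mpoly.

Set Implicit Arguments.
Unset Strict Implicit.
Unset Printing Implicit Defensive.

Import Order.TTheory GRing.Theory Num.Theory.

Local Open Scope classical_set_scope.
Local Open Scope ring_scope.

Local Notation msize := (mmeasure mdeg).
Local Notation "''X_' i" := (mpolyX _ (mnm1 i)) (at level 8, i at level 2).

Lemma mpoly_alg_ind (R : nzRingType) n (P : mpoly n R -> Prop) :
  (forall c, P (mpolyC n c)) -> (forall i, P 'X_i) ->
  (forall p q, P p -> P q -> P (p + q)) ->
  (forall p q, P p -> P q -> P (p * q)) -> forall p, P p.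
Proof.
move=> PC PX PD PM p; rewrite [p]mpolyE; elim/big_ind: _ => [|q r|m _].
- by rewrite -mpolyC0.
- exact: PD.
rewrite -mul_mpolyC; apply/PM => //; rewrite mpolyXE_id.
elim/big_ind: _ => [|q r|i _]; [by rewrite -mpolyC1 | exact: PM |].
by elim: (m i) => [|k IH]; rewrite ?exprS ?expr0 -?mpolyC1 //; apply: PM.
Qed.

Section Ideals.
Variables (F : fieldType) (n : nat).
Local Notation A := (mpoly n F).
Implicit Types (I : A -> Prop) (x y h : A).

Definition is_ideal I :=
  [/\ I 0, forall x y, I x -> I y -> I (x + y) & forall a x, I x -> I (a * x)].

Definition adjoin I x : A -> Prop := fun h => exists a, I (h - a * x).

Definition ideal_gen m (g : 'I_m -> A) : A -> Prop :=
  fun h => exists a : 'I_m -> A, h = \sum_j a j * g j.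

Lemma idealN I x : is_ideal I -> I x -> I (- x).
Proof. by case=> _ _ IM Ix; rewrite -mulN1r; apply: IM. Qed.

Lemma ideal_sum I (T : Type) (r : seq T) (P : pred T) (h : T -> A) :
  is_ideal I -> (forall i, P i -> I (h i)) -> I (\sum_(i <- r | P i) h i).
Proof. by case=> I0 ID _ Ih; elim/big_ind: _. Qed.

Lemma ideal_gen_ideal m (g : 'I_m -> A) : is_ideal (ideal_gen g).
Proof.
split.
- by exists (fun=> 0); rewrite big1 // => j _; rewrite mul0r.
- move=> _ _ [a ->] [b ->]; exists (fun j => a j + b j).
  by rewrite -big_split; apply: eq_bigr => j _; rewrite /= mulrDl.
- move=> c _ [a ->]; exists (fun j => c * a j).
  by rewrite big_distrr; apply: eq_bigr => j _; rewrite /= mulrA.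
Qed.

Lemma ideal_genP m (g : 'I_m -> A) j : ideal_gen g (g j).
Proof.
exists (fun i => (i == j)%:R); rewrite (bigD1 j) //= eqxx mul1r big1 ?addr0 //.
by move=> i /negbTE ->; rewrite mul0r.
Qed.

Lemma adjoin_ideal I x : is_ideal I -> is_ideal (adjoin I x).
Proof.
case=> I0 ID IM; split.
- by exists 0; rewrite mul0r subr0.
- move=> y z [a Ia] [b Ib]; exists (a + b).
  by rewrite mulrDl opprD addrACA; apply: ID.
- by move=> c y [a Ia]; exists (c * a); rewrite -mulrA -mulrBr; apply: IM.
Qed.

Lemma sub_adjoin I x h : I h -> adjoin I x h.
Proof. by exists 0; rewrite mul0r subr0. Qed.

Lemma mem_adjoin I x : is_ideal I -> adjoin I x x.
Proof. by case=> I0 _ _; exists 1; rewrite mul1r subrr. Qed.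

Lemma ideal_comp_mpoly I m (t : m.-tuple A) (c : 'I_m -> F) (q : mpoly m F) :
  is_ideal I -> (forall j, I (tnth t j - mpolyC n (c j))) ->
  I (comp_mpoly t q - mpolyC n (meval c q)).
Proof.
case=> I0 ID IM It; elim/mpoly_alg_ind: q => [a|i|p q Ip Iq|p q Ip Iq].
- by rewrite comp_mpolyC mevalC subrr.
- by rewrite comp_mpolyXU mevalXU -tnth_nth.
- by rewrite comp_mpolyD mevalD mpolyCD opprD addrACA; apply: ID.
- rewrite !rmorphM /=; set x := comp_mpoly t p; set y := comp_mpoly t q.
  have -> : x * y - mpolyC n (meval c p) * mpolyC n (meval c q) =
    x * (y - mpolyC n (meval c q)) +
    mpolyC n (meval c q) * (x - mpolyC n (meval c p)) by ring.
  by apply: ID; apply: IM.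
Qed.

(* If every I + (x - r) were the whole ring, then so would be
   I + (prod_r (x - r)), which is I when the product lies in I. *)
Lemma adjoin_root_proper I x (s : seq F) : is_ideal I -> ~ I 1 ->
  I (\prod_(r <- s) (x - mpolyC n r)) ->
  exists r, ~ adjoin I (x - mpolyC n r) 1.
Proof.
move=> idI I1 Is; apply: contrapT => /forallNP all1; apply: I1.
suff [a Ia] : exists a, I (1 - a * \prod_(r <- s) (x - mpolyC n r)).
  case: idI => _ ID IM.
  by rewrite -[1](subrK (a * \prod_(r <- s) (x - mpolyC n r))); auto.
elim: s {Is} => [|r s [a Ia]].
  by exists 1; rewrite big_nil mulr1 subrr; case: idI.
have /contrapT [b Ib] := all1 r.
case: idI => _ ID IM; exists (a * b); rewrite big_cons.
set P := \prod_(_ <- _) _; set y := x - _ in Ib *.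
have -> : 1 - a * b * (y * P) = (1 - a * P) + a * P * (1 - b * y) by ring.
by apply: ID => //; apply: IM.
Qed.

End Ideals.

Section Fibers.
Variables (n m K : nat).

Definition spanned (F : fieldType) (f : m.-tuple (mpoly n F))
    (v : 'I_K -> mpoly n F) (h : mpoly n F) :=
  exists q : 'I_K -> mpoly m F, h = \sum_a comp_mpoly f (q a) * v a.

Lemma fiber_size (F : fieldType) (f : m.-tuple (mpoly n F)) v (c : 'I_m -> F)
    (s : seq {ffun 'I_n -> F}) :
  (forall h, spanned f v h) -> uniq s ->
  {in s, forall b : {ffun 'I_n -> F}, forall j, meval b (tnth f j) = c j} ->
  (size s <= K)%N.
Proof.
move=> span us fs; rewrite leqNgt; apply/negP => ltKs.
pose b (i : 'I_(size s)) : {ffun 'I_n -> F} := nth [ffun=> 0] s i.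
pose M : 'M[F]_(size s, K) := \matrix_(i, a) meval (b i) (v a).
have : kermx M != 0.
  rewrite kermx_eq0 /row_free neq_ltn (leq_ltn_trans _ ltKs) //.
  exact: rank_leq_col.
case/rowV0Pn => u /sub_kermxP uM u0.
have ann h : \sum_i u 0 i * meval (b i) h = 0.
  have [q ->] := span h.
  under eq_bigr => i _.
    rewrite raddf_sum /= big_distrr /=.
    under eq_bigr => a _ do rewrite mevalM comp_mpoly_meval.
    over.
  rewrite exchange_big big1 //= => a _.
  have /rowP/(_ a) := uM; rewrite !mxE => ua.
  rewrite -[RHS](mulr0 (meval c (q a))) -[in RHS]ua big_distrr /=.
  apply: eq_bigr => i _; rewrite !mxE mulrCA; congr (_ * (_ * _)).
  by apply: meval_eq => j; apply: fs; apply: mem_nth.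
have [i ui] : exists i, u 0 i != 0.
  by apply/existsP; apply: contraNT u0; rewrite negb_exists => /forallP u0;
    apply/eqP/rowP => i; rewrite mxE; apply/eqP; have := u0 i; rewrite negbK.
have sep j : exists g : mpoly n F, j != i ->
    meval (b j) g = 0 /\ meval (b i) g != 0.
  have [->|ji] := eqVneq j i; first by exists 0.
  have : b j != b i by rewrite nth_uniq.
  rewrite -[b j == _]negbK => /negbNE bij.
  have [k bk] : exists k, b j k != b i k.
    apply/existsP; apply: contraNT bij; rewrite negb_exists => /forallP e.
    by apply/eqP/ffunP => k; apply/eqP; have := e k; rewrite negbK.
  exists ('X_k - mpolyC n (b j k)) => _.
  by rewrite !mevalB !mevalXU !mevalC subrr subr_eq0 eq_sym.
have [g gP] := choice sep.
set h := \prod_(j | j != i) g j.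
have hE k : meval (b k) h = \prod_(j | j != i) meval (b k) (g j).
  exact: rmorph_prod.
have := ann h; rewrite (bigD1 i) //= big1 => [|j ji]; last first.
  by rewrite hE (bigD1 j) //= (gP j ji).1 mul0r mulr0.
move/eqP; rewrite addr0 mulf_eq0 (negbTE ui) hE.
by apply/negP/prodf_neq0 => j /gP [].
Qed.

(* Nakayama's lemma (determinant trick). *)
Lemma fiber_ideal_proper (F : fieldType) (f : m.-tuple (mpoly n F)) v (c : 'I_m -> F) :
  (forall h, spanned f v h) -> (forall q, comp_mpoly f q = 0 -> q = 0) ->
  ~ ideal_gen (fun j => tnth f j - mpolyC n (c j)) 1.
Proof.
move=> span free [g g1].
have [q qP] := choice (fun aj : 'I_K * 'I_m => span (v aj.1 * g aj.2)).
pose Q : 'M[mpoly m F]_K :=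
  \matrix_(a, b) \sum_j ('X_j - mpolyC m (c j)) * q (a, j) b.
have Qv a : v a = \sum_b comp_mpoly f (Q a b) * v b.
  rewrite -[LHS]mulr1 g1 big_distrr /=.
  under [RHS]eq_bigr => b _ do rewrite mxE raddf_sum /= big_distrl /=.
  rewrite exchange_big /=; apply: eq_bigr => j _.
  rewrite mulrA (qP (a, j)) big_distrl /=; apply: eq_bigr => b _.
  rewrite rmorphM /= raddfB /= comp_mpolyC comp_mpolyXU -tnth_nth.
  by ring.
pose M := 1%:M - Q.
pose vc : 'cV[mpoly n F]_K := \col_a v a.
have Mv : map_mx (comp_mpoly f) M *m vc = 0.
  rewrite map_mxB map_mx1 mulmxBl mul1mx; apply/colP => a.
  rewrite !mxE [X in X - _]Qv; apply/eqP; rewrite subr_eq0; apply/eqP.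
  by apply: eq_bigr => b _; rewrite !mxE.
have det0 : \det (map_mx (comp_mpoly f) M) *: vc = 0.
  by rewrite -mul_scalar_mx -mul_adj_mx -mulmxA Mv mulmx0.
have : \det M = 0.
  apply: free; rewrite -det_map_mx -[LHS]mulr1.
  have [r ->] := span 1; rewrite big_distrr big1 //= => a _.
  by have /colP/(_ a) := det0; rewrite !mxE mulrCA => ->; rewrite mulr0.
move/(congr1 (meval c)); rewrite -det_map_mx raddf0.
suff -> : map_mx (meval c) M = 1%:M by rewrite det1 => /eqP; rewrite oner_eq0.
rewrite map_mxB map_mx1 (_ : map_mx _ Q = 0) ?subr0 //.
apply/matrixP => a b; rewrite !mxE raddf_sum /= big1 // => j _.
by rewrite rmorphM /= raddfB /= mevalXU mevalC subrr mul0r.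
Qed.

Lemma fiber_ideal_algebraic (F : fieldType) (f : m.-tuple (mpoly n F)) v
    (c : 'I_m -> F) (x : mpoly n F) :
  (forall h, spanned f v h) ->
  exists2 p : {poly F}, p != 0 &
    ideal_gen (fun j => tnth f j - mpolyC n (c j))
      (map_poly (@mpolyC n F) p).[x].
Proof.
move=> span; set J := ideal_gen _.
have idJ : is_ideal J by apply: ideal_gen_ideal.
have [q qP] := choice (fun t : nat => span (x ^+ t)).
pose M : 'M[F]_(K.+1, K) := \matrix_(t, a) meval c (q t a).
have : kermx M != 0.
  by rewrite kermx_eq0 /row_free neq_ltn ltnS rank_leq_col.
case/rowV0Pn => u /sub_kermxP uM u0.
exists (\poly_(t < K.+1) u 0 (inord t)).
  apply: contraNneq u0 => /polyP p0; apply/eqP/rowP => t; rewrite mxE.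
  by have := p0 t; rewrite coef_poly ltn_ord inord_val coef0.
rewrite -[X in J X]subr0.
have <- : \sum_a mpolyC n (\sum_(t < K.+1) u 0 t * meval c (q t a)) * v a = 0.
  rewrite big1 // => a _; have /rowP/(_ a) := uM; rewrite !mxE => ua.
  rewrite (_ : \sum_t _ = 0) ?mpolyC0 ?mul0r // -[RHS]ua.
  by apply: eq_bigr => t _; rewrite mxE.
rewrite poly_def raddf_sum /= horner_sum.
under [X in _ - X]eq_bigr => a _ do rewrite raddf_sum /= big_distrl /=.
rewrite exchange_big /= -sumrB; apply: ideal_sum => // t _.
rewrite map_polyZ /= map_polyXn hornerZ hornerXn inord_val qP big_distrr -sumrB /=.
apply: ideal_sum => // a _.
rewrite rmorphM /= -mulrA -mulrBr -mulrBl; case: (idJ) => _ _ IM.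
apply: (IM); rewrite mulrC; apply: IM.
by apply: ideal_comp_mpoly => // j; apply: ideal_genP.
Qed.

Lemma fiber_nonempty (F : closedFieldType) (f : m.-tuple (mpoly n F)) v
    (c : 'I_m -> F) :
  (forall h, spanned f v h) -> (forall q, comp_mpoly f q = 0 -> q = 0) ->
  exists b : 'I_n -> F, forall j, meval b (tnth f j) = c j.
Proof.
move=> span free.
have := fiber_ideal_proper (c := c) span free; set J := ideal_gen _ => J1.
have idJ : is_ideal J by apply: ideal_gen_ideal.
have [I [idI I1 JI IX]] : exists I, [/\ is_ideal I, ~ I 1, forall h, J h -> I h &
    forall i, i \in enum 'I_n -> exists r, I ('X_i - mpolyC n r)].
  elim: (enum 'I_n) => [|i s [I [idI I1 JI Is]]]; first by exists J; split.
  have [p p0 Jp] := fiber_ideal_algebraic c 'X_i span.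
  have [rs pE] := closed_field_poly_normal p.
  have [r Ir] : exists r, ~ adjoin I ('X_i - mpolyC n r) 1.
    apply: (@adjoin_root_proper _ _ _ _ rs) => //.
    set h := \prod_(_ <- _) _.
    have -> : h = mpolyC n (lead_coef p)^-1 * (map_poly (@mpolyC n F) p).[ 'X_i ].
      rewrite [X in map_poly _ X]pE map_polyZ hornerZ /= mulrA -rmorphM /=.
      rewrite mulVf ?lead_coef_eq0 // mpolyC1 mul1r rmorph_prod /= horner_prod.
      apply: eq_bigr => z _.
      by rewrite map_polyXsubC hornerXsubC.
    by case: idI => _ _ IM; apply/IM/JI.
  exists (adjoin I ('X_i - mpolyC n r)); split => //.
  - exact: adjoin_ideal.
  - by move=> h /JI; apply: sub_adjoin.
  - move=> j; rewrite inE => /predU1P [->|/Is [z Iz]].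
      by exists r; apply: mem_adjoin.
    by exists z; apply: sub_adjoin.
have [b bP] := choice (fun i => IX i (mem_enum _ i)).
exists b => j; apply/eqP; rewrite -subr_eq0; apply/eqP.
apply: contrapT => /eqP bc; apply: I1.
have If : I (tnth f j - mpolyC n (meval b (tnth f j))).
  rewrite -[X in X - _]comp_mpoly_id; apply: ideal_comp_mpoly => // i.
  by rewrite tnth_mktuple.
have Ic : I (tnth f j - mpolyC n (c j)) by apply/JI/ideal_genP.
set z := _ - _ in bc.
have -> : 1 = mpolyC n z^-1 * mpolyC n z by rewrite -rmorphM /= mulVf // mpolyC1.
case: (idI) => _ ID IM; apply: IM; rewrite raddfB /=.
set x := tnth f j in If Ic *.
have -> : mpolyC n (meval b x) - mpolyC n (c j) =
  (x - mpolyC n (c j)) + - (x - mpolyC n (meval b x)) by ring.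
by apply: ID => //; apply: idealN.
Qed.

End Fibers.

Section Measures.
Variables (n : nat) (R : comNzRingType) (mf : measure n).
Implicit Types p q : mpoly n R.

Lemma mmeasure_leP p k :
  (mmeasure mf p <= k)%N <-> (forall m, m \in msupp p -> (mf m < k)%N).
Proof.
split=> [pk m mp|H]; first exact: leq_trans (mmeasure_mnm_lt mf mp) pk.
by rewrite mmeasureE big_seq; apply/bigmax_leqP_seq => m mp _; apply: H.
Qed.

Lemma mmeasureM_leq p q a b : (mmeasure mf p <= a)%N -> (mmeasure mf q <= b.+1)%N ->
  (mmeasure mf (p * q) <= a + b)%N.
Proof.
move/mmeasure_leP => pa /mmeasure_leP qb; apply/mmeasure_leP => m.
case/msuppM_le/allpairsP => -[m1 m2] /= [/pa m1a /qb m2b ->].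
by rewrite mfD -addSn leq_add.
Qed.

Lemma mmeasure_sum_leq (T : Type) (r : seq T) (P : pred T) (h : T -> mpoly n R) k :
  (forall i, P i -> (mmeasure mf (h i) <= k)%N) ->
  (mmeasure mf (\sum_(i <- r | P i) h i) <= k)%N.
Proof.
move=> hk; elim/big_ind: _ => //; first by rewrite mmeasure0.
by move=> p q pk qk; apply: leq_trans (mmeasureD_le _ _ _) _; rewrite geq_max pk.
Qed.

Lemma mmeasureZ_leq c p k : (mmeasure mf p <= k)%N -> (mmeasure mf (c *: p) <= k)%N.
Proof.
by move/mmeasure_leP => pk; apply/mmeasure_leP => m /msuppZ_le; apply: pk.
Qed.

Lemma mmeasureXn_leq p k a : (mmeasure mf p <= a.+1)%N ->
  (mmeasure mf (p ^+ k) <= (k * a).+1)%N.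
Proof.
move=> pa; elim: k => [|k IH]; first by rewrite expr0 -mpolyC1 mmeasureC; case: eqP.
by rewrite exprS mulSn -addSn mmeasureM_leq.
Qed.

Lemma mmeasure1_leq : (mmeasure mf (1 : mpoly n R) <= 1)%N.
Proof. by rewrite -mpolyC1 mmeasureC leq_b1. Qed.

End Measures.

Lemma prod_mesym (n : nat) (R : comNzRingType) (s t : {poly mpoly n R}) :
  \prod_(i < n) (s * ('X_i)%:P + t) =
  \sum_(k < n.+1) (mesym n R k)%:P * s ^+ k * t ^+ (n - k).
Proof.
have leJ (J : {set 'I_n}) : (#|J| < n.+1)%N.
  by rewrite ltnS; apply: leq_trans (max_card _) _; rewrite card_ord.
have termE (J : {set 'I_n}) :
    \prod_i (if i \in J then s * ('X_i)%:P else t) =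
    (\prod_(i in J) 'X_i)%:P * s ^+ #|J| * t ^+ (n - #|J|).
  rewrite (bigID (mem J)) /=; congr (_ * _).
    rewrite (eq_bigr (fun i => s * ('X_i)%:P)) => [|i ->] //.
    by rewrite big_split /= prodr_const rmorph_prod mulrC.
  rewrite (eq_bigr (fun=> t)) => [|i /negbTE ->] //.
  rewrite prodr_const; congr (_ ^+ _).
  by rewrite -[X in (X - _)%N]card_ord -(cardC (mem J)) addKn; apply: eq_card.
rewrite bigA_distr /= (eq_bigr _ (fun J _ => termE J)).
rewrite (partition_big (fun J : {set 'I_n} => Ordinal (leJ J)) xpredT) //=.
apply: eq_bigr => k _; rewrite /mesym rmorph_sum /= !big_distrl /=.
by apply: eq_big => [J|J /eqP <-].
Qed.

Lemma size_prod_1subMX (R : comNzRingType) (x : nat -> R) (r : seq nat) :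
  (size (\prod_(l <- r) (1 - (x l)%:P * 'X))%R <= (size r).+1)%N.
Proof.
elim: r => [|l r IH]; first by rewrite big_nil size_poly1.
rewrite big_cons; apply: leq_trans (size_polyMleq _ _) _ => /=.
have : (size (1 - (x l)%:P * 'X)%R <= 2)%N.
  apply/leq_sizeP => -[|[|j]] // _.
  by rewrite coefB coef1 coefCM coefX /= mulr0 subr0.
by move=> h; rewrite -subn1 leq_subLR; apply: leq_trans (leq_add h IH) _.
Qed.

Section CompleteSymmetric.
Variables (A : comNzRingType) (x : nat -> A).

Fixpoint csym i k : A :=
  if i is i'.+1 then \sum_(l < k.+1) x i' ^+ l * csym i' (k - l)%N else (k == 0)%:R.

#[global] Arguments csym : simpl never.

Lemma csymS i k : csym i.+1 k = \sum_(l < k.+1) x i ^+ l * csym i (k - l)%N.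
Proof. by []. Qed.

Lemma csymS0 i : csym i 0 = 1.
Proof.
by elim: i => // i IH; rewrite csymS big_ord_recl big_ord0 addr0 expr0 mul1r IH.
Qed.

Lemma csymSS i k : csym i.+1 k.+1 = csym i k.+1 + x i * csym i.+1 k.
Proof.
rewrite !csymS big_ord_recl expr0 mul1r subn0; congr (_ + _).
by rewrite big_distrr; apply: eq_bigr => l _; rewrite /= exprS mulrA.
Qed.

(* In generating functions: prod_(l < n) (1 - x_l T) times
   sum_k csym i k T^k = 1 / prod_(l < i) (1 - x_l T). *)
Lemma csym_convolution n i k : (i <= n)%N ->
  \sum_(j < k.+1) (\prod_(0 <= l < n) (1 - (x l)%:P * 'X))`_j * csym i (k - j)%N =
  (\prod_(i <= l < n) (1 - (x l)%:P * 'X))`_k.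
Proof.
elim: i k => [|i IH] k lein.
  set E := \prod_(_ <= _ < _) _.
  rewrite big_ord_recr /= subnn [csym 0 0]/csym mulr1 big1 ?add0r // => j _.
  by rewrite /csym subn_eq0 leqNgt ltn_ord mulr0.
elim: k => [|k IHk].
  have := IH 0%N (ltnW lein).
  rewrite !big_ord_recl !big_ord0 !csymS0 (big_ltn lein) => ->.
  by rewrite mulrBl mul1r coefB -mulrA coefCM coefXM mulr0 subr0.
have := IH k.+1 (ltnW lein); rewrite (big_ltn lein).
rewrite mulrBl mul1r coefB -mulrA coefCM coefXM /= -IHk => /eqP.
rewrite eq_sym subr_eq => /eqP ->.
set E := \prod_(0 <= _ < _) _.
rewrite [LHS]big_ord_recr [in RHS]big_ord_recr /= subnn !csymS0 addrAC.
congr (_ + _).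
rewrite big_distrr -big_split /=; apply: eq_bigr => j _.
by rewrite subSn -1?ltnS // csymSS; ring.
Qed.

Lemma csym_eliminated n i : (i < n)%N ->
  \sum_(j < (n - i).+1)
    (\prod_(0 <= l < n) (1 - (x l)%:P * 'X))`_j * csym i.+1 (n - i - j)%N = 0.
Proof.
move=> lin; rewrite csym_convolution // nth_default //.
apply: leq_trans (size_prod_1subMX _ _) _.
by rewrite size_iota subnSK.
Qed.

End CompleteSymmetric.

Section ArtinBasis.
Variables (N : nat) (F : fieldType).
Local Notation A := (mpoly N F).
Local Notation mnmwgt := (mnmwgt (n := N)).

Let x (i : nat) : A := if insub i is Some j then 'X_(j : 'I_N) else 0.

Let xE (i : 'I_N) : x i = 'X_i.
Proof. by rewrite /x valK. Qed.

Let msize_x i : (msize (x i) <= 2)%N.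
Proof.
rewrite /x; case: insubP => [j _ _|_]; last by rewrite mmeasure0.
rewrite mmeasureX. by rewrite /= mdeg1.
Qed.

Let mweight_x i : (mmeasure mnmwgt (x i) <= i.+2)%N.
Proof.
rewrite /x; case: insubP => [j _ ji|_]; last by rewrite mmeasure0.
by rewrite mmeasureX /= mnmwgt1 -ji.
Qed.

Let mmeasure_csym (mf : measure N) (b : nat -> nat) i k :
  (forall l, (l < i)%N -> (mmeasure mf (x l) <= (b l).+1)%N) ->
  {homo b : m n / (m <= n)%N} ->
  (mmeasure mf (csym x i k) <= (k * b i.-1).+1)%N.
Proof.
move=> xb bm; elim: i k xb => [|i IH] k xb.
  by rewrite /csym; case: eqP => _; rewrite ?mmeasure0 // (leq_trans (mmeasure1_leq _ _)).
rewrite csymS; apply: mmeasure_sum_leq => l _.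
have lk : (l <= k)%N by rewrite -ltnS.
have h1 := mmeasureXn_leq l (xb i (ltnSn i)).
have h2 := IH (k - l)%N (fun j ji => xb j (ltnW ji)).
apply: leq_trans (mmeasureM_leq h1 h2) _ => /=.
have := bm _ _ (leq_pred i); nia.
Qed.

Let coef_prod_x j : (j <= N)%N ->
  (\prod_(0 <= l < N) (1 - (x l)%:P * 'X))`_j = (-1) ^+ j * mesym N F j.
Proof.
move=> jN; rewrite big_mkord.
rewrite (eq_bigr (fun i : 'I_N => (- 'X) * ('X_i)%:P + 1)) => [|i _]; last first.
  by rewrite xE mulNr mulrC addrC.
have termE k : (mesym N F k)%:P * (- 'X) ^+ k * 1 ^+ (N - k) =
    ((-1) ^+ k * mesym N F k)%:P * 'X^k :> {poly A}.
  rewrite expr1n mulr1 [(- 'X) ^+ k]exprNn mulrA rmorphM rmorphXn /= polyCN.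
  by rewrite [_%:P * _]mulrC.
rewrite prod_mesym coef_sum (bigD1 (Ordinal (jN : (j < N.+1)%N))) //= termE.
rewrite coefCM coefXn eqxx mulr1 big1 ?addr0 // => l /negbTE; rewrite -val_eqE /= => lj.
by rewrite termE coefCM coefXn eq_sym lj mulr0.
Qed.

(* Lexicographic induction on the degree and then on the weight
   sum_i (i + 1) * m_i. If m_i >= k := N - i, the factor x_i^k is rewritten using
   the complete symmetric polynomial of degree k in the first i + 1 variables: it
   lies in the ideal of the e_j, and its other monomials have smaller weight. *)
Lemma artin_generation (f : N.-tuple A) (M : A -> Prop) :
  (forall j : 'I_N, (msize (tnth f j - mesym N F j.+1) <= j.+1)%N) ->
  M 0 -> (forall p q, M p -> M q -> M (p + q)) ->
  (forall a p, M p -> M (a *: p)) -> (forall j p, M p -> M (tnth f j * p)) ->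
  (forall m : multinom N, (forall i : 'I_N, (m i < N - i)%N) -> M (mpolyX F m)) ->
  forall p, M p.
Proof.
move=> fe S0 SD SZ Sf SA.
have SN p : M p -> M (- p) by rewrite -scaleN1r; apply: SZ.
have Ssum (T : Type) (r : seq T) (P : pred T) h : (forall i, P i -> M (h i)) ->
    M (\sum_(i <- r | P i) h i) by move=> Sh; elim/big_ind: _.
have Ssupp p : (forall m, m \in msupp p -> M (mpolyX F m)) -> M p.
  by move=> Sp; rewrite [p]mpolyE big_seq; apply: Ssum => m /Sp; apply: SZ.
suff Sd d p : (msize p <= d)%N -> M p by move=> p; apply: (Sd _ _ (leqnn _)).
elim: d p => [|d IHd] p.
  by rewrite leqn0 mmeasure_poly_eq0 => /eqP ->.
suff Sm w (m : multinom N) : (mnmwgt m < w)%N -> (mdeg m <= d)%N -> M (mpolyX F m).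
  by move/mmeasure_leP => pd; apply: Ssupp => m /pd; apply: Sm (ltnSn _).
elim: w m => // w IHw m; rewrite ltnS => mw md.
have [/forallP|] := boolP [forall i : 'I_N, (m i < N - i)%N]; first exact: SA.
rewrite negb_forall => /existsP [i ki]; move: ki; rewrite -leqNgt.
have := ltn_ord i; rewrite -subn_gt0; set k := (N - i)%N => k0 ki.
have kN : (k <= N)%N by rewrite leq_subr.
pose u := mnm_muln (mnm1 i) k; pose m' := mnm_sub m u.
have mE : m = mnm_add m' u.
  rewrite submK //; apply/mnm_lepP => j; rewrite mulmnE mnm1E.
  by case: eqP => [<-|]; rewrite ?mul1n ?mul0n.
have dE : mdeg m = (mdeg m' + k)%N by rewrite {1}mE mdegD mdegMn mdeg1 mul1n.
have wE : mnmwgt m = (mnmwgt m' + k * i.+1)%N.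
  rewrite {1}mE mnmwgtD; congr (_ + _)%N; rewrite /mpoly.mnmwgt (bigD1 i) //=.
  rewrite mulmnE mnm1E eqxx mul1n big1 ?addn0 // => j ji.
  by rewrite mulmnE mnm1E eq_sym (negbTE ji).
have dm' : (msize (mpolyX F m') <= (mdeg m').+1)%N by rewrite mmeasureX.
have wm' : (mmeasure mnmwgt (mpolyX F m') <= (mnmwgt m').+1)%N by rewrite mmeasureX.
have dcs i' k' : (msize (csym x i' k') <= k'.+1)%N.
  by rewrite -[k' in k'.+1]muln1; apply: (mmeasure_csym (b := fun=> 1%N)).
have XkE : 'X_i ^+ k = csym x i.+1 k - \sum_(l < k) x i ^+ l * csym x i (k - l)%N.
  by rewrite csymS big_ord_recr /= subnn csymS0 mulr1 xE [X in X - _]addrC addrK.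
have csE : csym x i.+1 k =
    - \sum_(j < k) ((-1) ^+ j.+1 * mesym N F j.+1) * csym x i.+1 (k - j.+1)%N.
  apply/eqP; rewrite -addr_eq0; apply/eqP.
  rewrite -[RHS](csym_eliminated x (ltn_ord i)) -/k big_ord_recl; congr (_ + _).
    by rewrite coef_prod_x // mul1r mesym0E mul1r subn0.
  apply: eq_bigr => j _; rewrite coef_prod_x //.
  by apply: leq_trans kN; apply: ltn_ord.
rewrite mE mpolyXD -mpolyXn XkE mulrBr; apply: (SD).
- rewrite csE mulrN big_distrr; apply/SN/Ssum => j _ /=.
  set g := csym _ _ _; set X' := mpolyX F m'.
  have jN : (j < N)%N := leq_trans (ltn_ord j) kN.
  pose j' := Ordinal jN; have := fe j'; set r := _ - _ => rj.
  have eE : mesym N F j.+1 = tnth f j' - r by rewrite opprB addrC subrK.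
  have gX : (msize (X' * g) <= (mdeg m' + (k - j.+1)).+1)%N.
    exact: mmeasureM_leq dm' (dcs _ _).
  have -> : X' * ((-1) ^+ j.+1 * mesym N F j.+1 * g) =
     (-1) ^+ j.+1 * (tnth f j' * (X' * g) - r * (X' * g)) by rewrite eE; ring.
  have jk := ltn_ord j.
  suff : M (tnth f j' * (X' * g) - r * (X' * g)).
    by rewrite -signr_odd; case: odd; rewrite ?mulN1r ?mul1r //; apply: SN.
  apply: SD; first by apply/Sf/IHd; apply: leq_trans gX _; lia.
  apply/SN/IHd; apply: leq_trans (mmeasureM_leq rj gX) _; rewrite /=; lia.
- rewrite big_distrr; apply/SN/Ssum => l _ /=; apply: Ssupp => m2 m2p.
  have lk := ltn_ord l.
  apply: IHw.
  + apply: leq_trans mw; rewrite wE.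
    have hx := mmeasureXn_leq l (mweight_x i).
    have hc : (mmeasure mnmwgt (csym x i (k - l)%N) <= ((k - l) * i).+1)%N.
      case: (i : nat) => [|i'].
        by rewrite /csym subn_eq0 [(k <= l)%N]leqNgt lk mmeasure0.
      apply: (mmeasure_csym (b := succn)) => //.
    have /mmeasure_leP/(_ _ m2p) : (mmeasure mnmwgt
        (mpolyX F m' * (x i ^+ l * csym x i (k - l)%N)) <=
        (mnmwgt m' + (l * i.+1 + (k - l) * i)).+1)%N.
      exact: mmeasureM_leq wm' (mmeasureM_leq hx hc).
    rewrite ltnS => h; apply: leq_ltn_trans h _.
    by rewrite ltn_add2l -[in X in (_ < X)%N](subnK (ltnW lk)) mulnDl; nia.
  + have hx := mmeasureXn_leq l (msize_x i).
    have /mmeasure_leP/(_ _ m2p) : (msize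
        (mpolyX F m' * (x i ^+ l * csym x i (k - l)%N)) <=
        (mdeg m' + (l * 1 + (k - l))).+1)%N.
      exact: mmeasureM_leq dm' (mmeasureM_leq hx (dcs i (k - l)%N)).
    by rewrite muln1 subnKC ?(ltnW lk) // -dE => h; apply: leq_trans md.
Qed.

End ArtinBasis.

Section AlgebraicIndependence.
Variables (N : nat) (F : fieldType).
Local Notation A := (mpoly N F).

(* The powers f^m and e^m are [near] with w the weight of m. *)
Let near w (p q : A) :=
  [/\ (msize p <= w.+1)%N, (msize q <= w.+1)%N & (msize (p - q) <= w)%N].

Let near1 : near 0 1 1.
Proof. by split; rewrite ?subrr ?mmeasure0 ?mmeasure1_leq. Qed.

Let nearM w1 w2 p1 q1 p2 q2 :
  near w1 p1 q1 -> near w2 p2 q2 -> near (w1 + w2) (p1 * p2) (q1 * q2).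
Proof.
move=> [p1w q1w d1] [p2w q2w d2]; split.
- exact: mmeasureM_leq p1w p2w.
- exact: mmeasureM_leq q1w q2w.
have -> : p1 * p2 - q1 * q2 = (p1 - q1) * p2 + (p2 - q2) * q1 by ring.
apply: leq_trans (mmeasureD_le _ _ _) _; rewrite geq_max (mmeasureM_leq d1 p2w).
by rewrite addnC (mmeasureM_leq d2 q1w).
Qed.

Lemma near_mesym_comp_eq0 (f : N.-tuple A) :
  (forall j : 'I_N, (msize (tnth f j - mesym N F j.+1) <= j.+1)%N) ->
  forall q, comp_mpoly f q = 0 -> q = 0.
Proof.
move=> fe q fq; apply/eqP; rewrite -(mmeasure_poly_eq0 (mnmwgt (n := N))).
case dE : (mmeasure _ q) => [//|d].
pose e := [tuple mesym N F i.+1 | i < N].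
have esz (j : 'I_N) : (msize (tnth e j) <= j.+2)%N.
  rewrite tnth_mktuple; apply/mmeasure_leP => m.
  by rewrite msupp_mesymP => /existsP [J /andP [/eqP <- /eqP ->]]; rewrite /= mdeg_mesym1.
have near_f (j : 'I_N) : near j.+1 (tnth e j) (tnth f j).
  have fej : (msize (tnth e j - tnth f j) <= j.+1)%N.
    by rewrite -opprB mmeasureN tnth_mktuple fe.
  split=> //; rewrite -[tnth f j](subKr (tnth e j)) addrC.
  apply: leq_trans (mmeasureD_le _ _ _) _; rewrite geq_max mmeasureN esz.
  by rewrite (leq_trans fej).
have near_comp m :
    near (mnmwgt m) (\prod_i tnth e i ^+ m i) (\prod_i tnth f i ^+ m i).
  rewrite /mnmwgt; elim/big_ind3: _ => // [w1 w2 w3 w4 w5 w6|i _]; first exact: nearM.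
  elim: (m i) => [|k IH] //.
  by rewrite !exprS mulSn; apply: nearM.
have ed : (msize (comp_mpoly e q) <= d)%N.
  rewrite -[comp_mpoly e q]subr0 -fq !comp_mpolyE -sumrB big_seq.
  apply: mmeasure_sum_leq => m mq; rewrite -scalerBr; apply: mmeasureZ_leq.
  have [_ _ h] := near_comp m; apply: leq_trans h _.
  by have := mmeasure_mnm_lt (mnmwgt (n := N)) mq; rewrite dE.
have top0 : pihomog (mnmwgt (n := N)) d q = 0.
  apply: (@msym_fundamental_un0 N F); rewrite -pihomog_mPo pihomogE.
  rewrite big_seq_cond big1 // => m /andP [/(mmeasure_mnm_lt mdeg) md /eqP dm].
  by have := leq_trans md ed; rewrite dm ltnn.
have : (mmeasure (mnmwgt (n := N)) q <= d)%N.
  have qd : (mmeasure (mnmwgt (n := N)) q <= d.+1)%N by rewrite dE.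
  rewrite (pihomog_partitionE qd) big_ord_recr /= top0 addr0.
  apply: mmeasure_sum_leq => i _; rewrite pihomogE; apply: mmeasure_sum_leq => m /eqP mi.
  by apply: mmeasureZ_leq; rewrite mmeasureX mi.
by rewrite dE ltnn.
Qed.

End AlgebraicIndependence.

Section SymmetricSystem.
Variables (N : nat).

Lemma card_artin : #|{dffun forall i : 'I_N, 'I_(N - i)}| = N`!.
Proof.
rewrite card_dep_ffun foldrE big_map big_enum /=.
under eq_bigr => i _ do rewrite card_ord.
rewrite fact_prod big_add1 big_mkord [RHS](reindex_inj rev_ord_inj) /=.
by apply: eq_bigr => i _; rewrite subnSK.
Qed.

Lemma artin_spanned (F : fieldType) (f : N.-tuple (mpoly N F)) :
  (forall j : 'I_N, (msize (tnth f j - mesym N F j.+1) <= j.+1)%N) ->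
  exists v : 'I_(N`!) -> mpoly N F, forall h, spanned f v h.
Proof.
move=> fe; pose T := {dffun forall i : 'I_N, 'I_(N - i)}.
rewrite -card_artin -/T.
pose mon (a : T) := Multinom [tuple a i : nat | i < N].
pose v (a : 'I_#|T|) := mpolyX F (mon (enum_val a)).
exists v; apply: (artin_generation fe).
- by exists (fun=> 0); rewrite big1 // => a _; rewrite comp_mpoly0 mul0r.
- move=> _ _ [p ->] [q ->]; exists (fun a => p a + q a).
  by rewrite -big_split; apply: eq_bigr => a _; rewrite comp_mpolyD mulrDl.
- move=> c _ [p ->]; exists (fun a => c *: p a).
  by rewrite scaler_sumr; apply: eq_bigr => a _; rewrite comp_mpolyZ scalerAl.
- move=> j _ [p ->]; exists (fun a => 'X_j * p a).
  rewrite big_distrr; apply: eq_bigr => a _.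
  by rewrite rmorphM /= comp_mpolyXU -tnth_nth mulrA.
move=> m mN; pose a : T := [ffun i => Ordinal (mN i)].
exists (fun b => (b == enum_rank a)%:R); rewrite (bigD1 (enum_rank a)) //= eqxx.
rewrite comp_mpoly1 mul1r big1 => [|b /negbTE ->]; last by rewrite comp_mpoly0 mul0r.
rewrite addr0 /v enum_rankK; congr mpolyX; apply/mnmP => i.
by rewrite [RHS]mnmE ffunE.
Qed.

End SymmetricSystem.

Section DegreeBound.
Variables (n : nat) (R : comNzRingType).
Implicit Types P Q : {poly mpoly n R}.

(* Total degree less than w, in the n variables and 'X together; truncated
   subtraction makes the coefficients beyond w vanish. *)
Definition tdeg_lt w P := forall k, (msize P`_k <= w - k)%N.

Lemma tdeg_lt_mono w w' P : (w <= w')%N -> tdeg_lt w P -> tdeg_lt w' P.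
Proof. by move=> ww Pw k; apply: leq_trans (Pw k) _; apply: leq_sub2r. Qed.

Lemma tdeg_lt0 w : tdeg_lt w 0.
Proof. by move=> k; rewrite coef0 mmeasure0. Qed.

Lemma tdeg_lt1 : tdeg_lt 1 1.
Proof.
by move=> [|k]; rewrite coef1 /= ?mmeasure0 // (leq_trans (mmeasure1_leq _ _)).
Qed.

Lemma tdeg_ltB w P Q : tdeg_lt w P -> tdeg_lt w Q -> tdeg_lt w (P - Q).
Proof.
move=> Pw Qw k; rewrite coefB; apply: leq_trans (mmeasureD_le _ _ _) _.
by rewrite mmeasureN geq_max Pw Qw.
Qed.

Lemma tdeg_ltM a b P Q : tdeg_lt a P -> tdeg_lt b.+1 Q -> tdeg_lt (a + b) (P * Q).
Proof.
move=> Pa Qb k; rewrite coefM; apply: mmeasure_sum_leq => i _.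
have ik := ltn_ord i; have := Pa i; have := Qb (k - i)%N.
have [bk|bk] := leqP b.+1 (k - i).
  have /eqP -> : (b.+1 - (k - i) == 0)%N by rewrite subn_eq0.
  by rewrite leqn0 mmeasure_poly_eq0 => /eqP -> _; rewrite mulr0 mmeasure0.
have [ai|ai] := leqP a i.
  have /eqP -> : (a - i == 0)%N by rewrite subn_eq0.
  by rewrite leqn0 mmeasure_poly_eq0 => _ /eqP ->; rewrite mul0r mmeasure0.
rewrite subSn // => Qk Pi; apply: leq_trans (mmeasureM_leq Pi Qk) _; lia.
Qed.

Lemma tdeg_lt_mpolyXsubX (i : 'I_n) : tdeg_lt 2 (('X_i)%:P - 'X).
Proof.
move=> [|[|k]]; rewrite coefB coefC coefX /= ?subr0 ?sub0r ?subrr ?mmeasure0 //.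
  by rewrite mmeasureX /= mdeg1.
by rewrite mmeasureN mmeasure1_leq.
Qed.

End DegreeBound.

Section Discriminant.

Lemma schr_sol_fwd (C : comNzRingType) (b : int -> C) l x y m :
  (schr_sol b l x y m%:Z, schr_sol b l x y m.+1%:Z) = schr_fwd b l (x, y) m.
Proof.
have [eqn w0 w1] := schr_solP b l x y.
elim: m => [|m IH] /=; first by rewrite w0 w1.
rewrite -IH /=; congr (_, _); move/schr_eqE: (eqn m.+1%:Z).
rewrite (_ : m.+1%:Z + 1 = m.+2%:Z); last by lia.
by rewrite (_ : m.+1%:Z - 1 = m%:Z) //; lia.
Qed.

Lemma hill_discriminant_fwd (C : comNzRingType) N (b : int -> C) l :
  hill_discriminant N b l = (schr_fwd b l (1, 0) N).1 + (schr_fwd b l (0, 1) N).2.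
Proof.
rewrite /hill_discriminant /schr_chi /schr_gamma -!schr_sol_fwd /=.
by rewrite (_ : N%:Z + 1 = N.+1%:Z) //; lia.
Qed.

Lemma schr_fwd_rmorph (C D : comNzRingType) (phi : {rmorphism C -> D}) N
    (b : int -> C) (b' : int -> D) l x y :
  (forall i, (i < N)%N -> b' i.+1%:Z = phi (b i.+1%:Z)) ->
  schr_fwd b' (phi l) (phi x, phi y) N =
  (phi (schr_fwd b l (x, y) N).1, phi (schr_fwd b l (x, y) N).2).
Proof.
elim: N => [|N IH] //= bb'; rewrite IH => [|i iN]; last by apply/bb'/ltnW.
by rewrite /= bb' // rmorphB rmorphM rmorphB.
Qed.

Variables (N : nat) (F : fieldType).
Local Notation A := (mpoly N F).

(* Only the sites 1, ..., N enter the discriminant. *)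
Let B (k : int) : {poly A} := if insub `|k|.-1 is Some i then ('X_(i : 'I_N))%:P else 0.

Let BE (i : 'I_N) : B i.+1%:Z = ('X_i)%:P.
Proof. by rewrite /B valK. Qed.

Definition hill_poly : {poly mpoly N F} := hill_discriminant N B 'X.

Lemma hill_polyP (b : int -> F) (beta : 'I_N -> F) l :
  (forall i : 'I_N, b i.+1%:Z = beta i) ->
  hill_discriminant N b l = (map_poly (meval beta) hill_poly).[l].
Proof.
move=> bE; pose phi : {rmorphism {poly A} -> F} := horner_eval l \o map_poly (meval beta).
have phiB i : (i < N)%N -> b i.+1%:Z = phi (B i.+1%:Z).
  move=> iN; rewrite (BE (Ordinal iN)) (bE (Ordinal iN)) /phi /=.
  by rewrite map_polyC /= mevalXU /horner_eval hornerC.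
have phiX : phi 'X = l by rewrite /phi /= map_polyX /horner_eval hornerX.
rewrite -[RHS]/(phi hill_poly) /hill_poly !hill_discriminant_fwd rmorphD.
have h x y := schr_fwd_rmorph (phi := phi) 'X x y phiB.
have := h 1 0; have := h 0 1; rewrite phiX rmorph1 rmorph0.
by move=> -> ->.
Qed.

Lemma hill_poly_tdeg : (0 < N)%N ->
  tdeg_lt N (hill_poly - \prod_(i < N) (('X_i)%:P - 'X)).
Proof.
move=> N0; pose X k : {poly A} := B k.+1%:Z - 'X.
have XE (i : 'I_N) : X i = ('X_i)%:P - 'X by rewrite /X BE.
have Xd m k P : (k < N)%N -> tdeg_lt m P -> tdeg_lt m.+1 (X k * P).
  move=> kN Pm; rewrite mulrC -addn1; apply: tdeg_ltM => //.
  by rewrite (XE (Ordinal kN)); apply: tdeg_lt_mpolyXsubX.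
have chi m : (m <= N)%N -> let p := schr_fwd B 'X (1, 0) m in
    tdeg_lt (maxn 1 m) p.1 /\ tdeg_lt m.+1 p.2.
  elim: m => [|m IH] mN; first by split; [exact: tdeg_lt1 | exact: tdeg_lt0].
  have [p1 p2] := IH (ltnW mN); split; first by rewrite (maxn_idPr _).
  rewrite /= -/(X m). apply: tdeg_ltB; first exact: Xd.
  by apply: tdeg_lt_mono p1; lia.
have gamma m : (m <= N)%N -> let p := schr_fwd B 'X (0, 1) m in
    [/\ tdeg_lt m p.1, tdeg_lt m.+1 p.2 & tdeg_lt m (p.2 - \prod_(k < m) X k)].
  elim: m => [|m IH] mN.
    rewrite big_ord0 /= subrr.
    by split; [exact: tdeg_lt0 | exact: tdeg_lt1 | exact: tdeg_lt0].
  have [p1 p2 p3] := IH (ltnW mN); split=> //=; rewrite -/(X m).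
    by apply: tdeg_ltB; [exact: Xd | apply: tdeg_lt_mono p1; lia].
  rewrite big_ord_recr /= -/(X m); set q := schr_fwd _ _ _ _ in p1 p2 p3 *.
  have -> : X m * q.2 - q.1 - \prod_(k < m) X k * X m =
      X m * (q.2 - \prod_(k < m) X k) - q.1 by ring.
  by apply: tdeg_ltB; [exact: Xd | apply: tdeg_lt_mono p1].
have [c1 _] := chi N (leqnn N); have [_ _ g3] := gamma N (leqnn N).
rewrite /hill_poly hill_discriminant_fwd -(eq_bigr _ (fun i _ => XE i)).
set g := (schr_fwd _ _ _ _).2 in g3 *; set P := \prod_(_ < _) _ in g3 *.
have -> : forall c, c + g - P = (g - P) - (0 - c) by move=> c; ring.
apply: tdeg_ltB => //; apply: tdeg_ltB; first exact: tdeg_lt0.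
by apply: tdeg_lt_mono c1; rewrite geq_max N0 leqnn.
Qed.

Lemma coef_prod_mpolyXsubX j : (j <= N)%N ->
  (\prod_(i < N) (('X_i)%:P - 'X) : {poly A})`_(N - j) =
  (-1) ^+ (N - j) * mesym N F j.
Proof.
move=> jN; rewrite (eq_bigr (fun i : 'I_N => 1 * ('X_i)%:P + (- 'X))); last first.
  by move=> i _; rewrite mul1r.
have termE k : (mesym N F k)%:P * 1 ^+ k * (- 'X) ^+ (N - k) =
    ((-1) ^+ (N - k) * mesym N F k)%:P * 'X^(N - k) :> {poly A}.
  rewrite expr1n mulr1 [(- 'X) ^+ _]exprNn mulrA rmorphM rmorphXn /= polyCN.
  by rewrite [_%:P * _]mulrC.
rewrite prod_mesym coef_sum (bigD1 (Ordinal (jN : (j < N.+1)%N))) //= termE.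
rewrite coefCM coefXn eqxx mulr1 big1 ?addr0 // => l; rewrite -val_eqE /= => lj.
rewrite termE coefCM coefXn (_ : _ == _ = false) ?mulr0 //.
by apply/negbTE; have := ltn_ord l; move: lj; lia.
Qed.

(* The coefficients of the discriminant, up to sign, normalized so that the
   top homogeneous part is the elementary symmetric polynomial. *)
Definition hill_coef : N.-tuple (mpoly N F) :=
  [tuple (-1) ^+ (N - j.+1) * hill_poly`_(N - j.+1) | j < N].

Lemma hill_coef_mesym (j : 'I_N) :
  (msize (tnth hill_coef j - mesym N F j.+1) <= j.+1)%N.
Proof.
have N0 : (0 < N)%N := leq_ltn_trans (leq0n _) (ltn_ord j).
have := hill_poly_tdeg N0 (N - j.+1)%N; rewrite coefB coef_prod_mpolyXsubX //.
rewrite subKn // tnth_mktuple -signr_odd; set h := hill_poly`_ _.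
case: odd; rewrite ?mulN1r ?mul1r // opprK.
by rewrite -[- h - _]opprD mmeasureN.
Qed.

Lemma hill_poly_coefN : (0 < N)%N -> hill_poly`_N = (-1) ^+ N.
Proof.
move=> N0; have := hill_poly_tdeg N0 N; rewrite subnn leqn0 mmeasure_poly_eq0.
rewrite coefB -[X in _ - _`_X]subn0 coef_prod_mpolyXsubX // mesym0E mulr1 subn0.
by rewrite subr_eq0 => /eqP.
Qed.

Lemma size_hill_poly : (0 < N)%N -> (size hill_poly <= N.+1)%N.
Proof.
move=> N0; pose P : {poly A} := \prod_(i < N) (('X_i)%:P - 'X).
have Pd : tdeg_lt N.+1 P.
  rewrite /P -big_enum /= -[N in tdeg_lt N.+1 _]size_enum_ord.
  elim: (enum 'I_N) => [|i r IH]; first by rewrite big_nil; apply: tdeg_lt1.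
  rewrite big_cons mulrC -[size _]addn1 -addSn /=; apply: tdeg_ltM => //.
  exact: tdeg_lt_mpolyXsubX.
have : tdeg_lt N.+1 hill_poly.
  have -> : hill_poly = (hill_poly - P) - (0 - P) by ring.
  apply: tdeg_ltB; first exact: tdeg_lt_mono (leqnSn N) (hill_poly_tdeg N0).
  by apply: tdeg_ltB => //; apply: tdeg_lt0.
move=> hd; apply/leq_sizeP => k Nk; apply/eqP.
rewrite -(mmeasure_poly_eq0 (mdeg (n := N))) -leqn0.
by apply: leq_trans (hd k) _; rewrite leqn0 subn_eq0.
Qed.

End Discriminant.

Lemma horner_inj (F : numFieldType) (p q : {poly F}) :
  (forall x, p.[x] = q.[x]) -> p = q.
Proof.
move=> pq; apply/eqP; rewrite -subr_eq0; apply/negPn/negP => pq0.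
pose rs : seq F := [seq k%:R | k <- iota 0 (size (p - q))].
have : (size rs < size (p - q)%R)%N.
  apply: max_poly_roots => //.
    by apply/allP => x _; rewrite /root hornerD hornerN pq subrr.
  by rewrite map_inj_uniq ?iota_uniq //; apply: mulrIn (oner_neq0 F).
by rewrite size_map size_iota ltnn.
Qed.

Lemma hill_discriminant_coef (F : numFieldType) N (c : 'I_N -> F) (b : int -> F) :
  (0 < N)%N ->
  (forall l, hill_discriminant N b l = (-1) ^+ N * l ^+ N + \sum_(k < N) c k * l ^+ k)
  <-> (forall j : 'I_N, meval (fun i : 'I_N => b i.+1%:Z) (tnth (hill_coef N F) j) =
        (-1) ^+ (N - j.+1) * c (rev_ord j)).
Proof.
move=> N0; set beta := fun _ => _; pose p := map_poly (meval beta) (hill_poly N F).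
pose q := (-1) ^+ N *: 'X^N + \poly_(k < N) c (insubd (Ordinal N0) k).
have pE l : hill_discriminant N b l = p.[l] by apply: hill_polyP.
have qE l : (-1) ^+ N * l ^+ N + \sum_(k < N) c k * l ^+ k = q.[l].
  rewrite hornerD hornerZ hornerXn horner_poly; congr (_ + _).
  by apply: eq_bigr => k _; rewrite valKd.
have p_coef k : p`_k = meval beta (hill_poly N F)`_k by rewrite coef_map.
have q_coef (k : 'I_N) : q`_k = c k.
  rewrite coefD coefZ coefXn ltn_eqF // mulr0 add0r coef_poly ltn_ord.
  by rewrite valKd.
have coefE (j : 'I_N) :
    meval beta (tnth (hill_coef N F) j) = (-1) ^+ (N - j.+1) * p`_(rev_ord j).
  by rewrite tnth_mktuple rmorphM rmorphXn rmorphN1 p_coef.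
split=> [pq j|pq l].
  rewrite coefE (_ : p = q) ?q_coef //; apply: horner_inj => l.
  by rewrite -pE -qE.
rewrite pE qE (_ : p = q) //; apply/polyP => k.
have [kN|] := ltnP k N.
  have /esym/eqP := coefE (rev_ord (Ordinal kN)).
  rewrite pq rev_ordK (inj_eq (mulrI _)); last by rewrite unitrX // unitrN1.
  by move/eqP => /= ->; rewrite -[k]/(val (Ordinal kN)) q_coef.
rewrite leq_eqVlt => /predU1P [<-|Nk].
  rewrite p_coef hill_poly_coefN // rmorphXn rmorphN1 coefD coefZ coefXn eqxx.
  by rewrite coef_poly ltnn mulr1 addr0.
rewrite p_coef nth_default; last by apply: leq_trans (size_hill_poly F N0) Nk.
rewrite raddf0 coefD coefZ coefXn gtn_eqF // mulr0 coef_poly.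
by rewrite ltnNge ltnW // addr0.
Qed.

Lemma periodicz (U V : zmodType) (f : U -> V) T (n : int) a :
  periodic f T -> f (a + T *~ n) = f a.
Proof.
move=> fT; case: n => n; first exact: periodicn.
by rewrite NegzE mulrNz -[LHS](periodicn fT n.+1) subrK.
Qed.

Lemma periodic_eq (N : nat) (V : zmodType) (b b' : int -> V) : (0 < N)%N ->
  periodic b N%:Z -> periodic b' N%:Z ->
  (forall i, (i < N)%N -> b i.+1%:Z = b' i.+1%:Z) -> b = b'.
Proof.
move=> N0 pb pb' bb'; apply/funext => n.
have N0z : N%:Z != 0 by case: N N0 {pb pb' bb'}.
have -> : n = `|((n - 1) %% N%:Z)%Z|.+1%:Z + N%:Z *~ ((n - 1) %/ N%:Z)%Z.
  rewrite intS gez0_abs ?modz_ge0 // -mulrzr intz mulrC.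
  have := divz_eq (n - 1) N%:Z.
  by move: (_ %/ _)%Z (_ %% _)%Z => d r e; rewrite addrAC -addrA -e addrC subrK.
rewrite !periodicz //; apply: bb'.
by rewrite -ltz_nat gez0_abs ?modz_ge0 // ltz_pmod.
Qed.

Lemma card_le_uniq_size (T : Type) (U : choiceType) (A : set T) (g : T -> U) n :
  {in A &, injective g} ->
  (forall s : seq U, uniq s -> (forall u, u \in s -> (g @` A) u) -> (size s <= n)%N) ->
  (A #<= `I_n)%card.
Proof.
move=> gI As; rewrite -(card_le_eql (inj_card_eq gI)).
have finA : finite_set (g @` A).
  apply: contrapT => /(infinite_set_fset n.+1) [X XA].
  rewrite leqNgt => /negP; apply; rewrite ltnS; apply: As.
    exact: finmap.fset_uniq.
  by move=> u uX; apply: XA.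
have [X XE] := finite_fsetP.1 finA.
rewrite XE (card_le_eql (introT card_eq_fsetP (erefl _))) card_le_II; apply: As.
  exact: finmap.fset_uniq.
by move=> u uX; rewrite XE.
Qed.

Theorem theorem1 (R : realType) (N : nat) (hN : (1 <= N)%N) (c : 'I_N -> R[i]) :
  let B := [set b : int -> R[i] |
    periodic b N%:Z /\
    forall l : R[i], hill_discriminant N b l =
      (-1) ^+ N * l ^+ N + \sum_(k < N) c k * l ^+ k] in
  B !=set0 /\ (B #<= `I_(N`!))%card.
Proof.
move=> B; pose F : numClosedFieldType := R[i].
have [v vP] := artin_spanned (@hill_coef_mesym N F).
have free := near_mesym_comp_eq0 (@hill_coef_mesym N F).
pose d (j : 'I_N) : F := (-1) ^+ (N - j.+1) * c (rev_ord j).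
split.
  have [beta betaP] := fiber_nonempty d vP free.
  pose b (n : int) : F := if insub `|((n - 1) %% N%:Z)%Z|%N is Some i then beta i else 0.
  have bE (i : 'I_N) : b i.+1%:Z = beta i.
    rewrite /b (_ : i.+1%:Z - 1 = i%:Z); last lia.
    by rewrite modz_small /= ?ltz_nat ?ltn_ord // valK.
  exists b; split; first by move=> n; rewrite /b addrAC modzDr.
  apply/hill_discriminant_coef => // j; rewrite -/(d j) -betaP.
  by apply: meval_eq => i; rewrite bE.
apply: (card_le_uniq_size (g := fun b : int -> F => [ffun i : 'I_N => b i.+1%:Z])).
  move=> b b' /set_mem [pb _] /set_mem [pb' _] /ffunP e.
  apply: periodic_eq pb pb' _ => // i iN.
  by have := e (Ordinal iN); rewrite !ffunE.
move=> s us sB.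
apply: (fiber_size vP us (c := d)).
move=> u /sB [b [_ /hill_discriminant_coef bP] <-] j.
by rewrite /d -bP //; apply: meval_eq => i; rewrite ffunE.
Qed.
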